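(* Let $0<T\le+\infty$, $\beta\in(0,1)$, $p>\frac1\beta$ and $q=\frac{p}{p-1}$. Let $a,b\in C[0,T)$ be nondecreasing, nonnegative functions, let $l\in C(0,T)\cap L^{p}_{Loc}[0,T)$ be a nonnegative function, and let $\omega\in C[0,+\infty)$ be a nondecreasing, nonnegative function. Assume that $u$ is a continuous, nonnegative function on $[0,T)$ with $$u(t)\le a(t)+b(t)\int_{0}^{t}(t-s)^{\beta-1}l(s)\,\omega(u(s))\,ds,\qquad t\in[0,T).$$ Then $$u(t)\le 2^{1-\frac1p}\left(\Omega^{-1}\left(\Omega(a^{p}(t))+c^{p}(t)\int_{0}^{t}l^{p}(s)\,ds\right)\right)^{\frac1p},\qquad t\in[0,T_{1}],$$ where $c(t)=\dfrac{t^{\beta-1+\frac1q}\,b(t)}{(q(\beta-1)+1)^{\frac1q}}$, $\mu(t)=\omega^{p}\big(2^{1-\frac1p}t^{\frac1p}\big)$, $\Omega(x)=\int_{1}^{x}\frac{1}{\mu(t)}\,dt$, $\Omega^{-1}$ is the inverse of $\Omega$, and $T_{1}\in(0,T)$ is such that $\Omega(a^{p}(t))+c^{p}(t)\int_{0}^{t}l^{p}(s)\,ds\in\mathrm{Dom}(\Omega^{-1})$ for all $t\in[0,T_{1}]$.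
   Context: $L^{p}_{Loc}[0,T)$ denotes the functions belonging to $L^p[0,T']$ for every $0<T'<T$. $\mathrm{Dom}(\Omega^{-1})$ is the domain of the inverse function $\Omega^{-1}$, i.e. the range of $\Omega$. For a function $g$, $g^p(t)$ means $(g(t))^p$. *)

(* Defs.v *)
From HB Require Import structures.
From mathcomp Require Import all_boot all_order all_algebra.
From mathcomp Require Import all_classical all_reals all_analysis.

Set Implicit Arguments.
Unset Strict Implicit.
Unset Printing Implicit Defensive.

Import Order.TTheory GRing.Theory Num.Theory.
Import numFieldNormedType.Exports.

Local Open Scope classical_set_scope.
Local Open Scope ring_scope.

(* [0, T) and (0, T), where T may be +oo. *)
Definition co_itv (R : realType) (T : \bar R) : set R :=
  [set t | 0 <= t /\ (t%:E < T)%E].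

Definition oo_itv (R : realType) (T : \bar R) : set R :=
  [set t | 0 < t /\ (t%:E < T)%E].

(* The value of f at 0 is irrelevant, so f need only be meaningful on (0, T). *)
Definition Lp_loc (R : realType) (p : R) (T : \bar R) (f : R -> R) : Prop :=
  forall T' : R, 0 < T' -> (T'%:E < T)%E ->
    f \_ `[0, T'] \in Lfun (@lebesgue_measure R) p%:E.

Definition mu_fun (R : realType) (p : R) (omega : R -> R) (t : R) : R :=
  omega (2 `^ (1 - p^-1) * t `^ p^-1) `^ p.

(* The oriented integral of 1/mu from 1 to x, with values in [-oo, +oo].  The
   inverse is that of \bar R, for which 0^-1 = +oo: a zero of mu counts as a
   singularity of the integrand (the inverse of R has 0^-1 = 0). *)
Definition Omega (R : realType) (p : R) (omega : R -> R) (x : R) : \bar R :=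
  (if (1 <= x)%R
   then \int[lebesgue_measure]_(t in `[1%R, x]) ((mu_fun p omega t)%:E)^-1
   else - \int[lebesgue_measure]_(t in `[x, 1%R]) ((mu_fun p omega t)%:E)^-1)%E.

(* The points x >= 0 where Omega x is finite, together with 0, where the value
   -oo is allowed (as when omega is the identity).  If omega > 0 on (0, +oo),
   this is all of [0, +oo).  Omega is injective on this set, even if omega
   vanishes on an interval. *)
Definition Omega_dom (R : realType) (p : R) (omega : R -> R) : set R :=
  [set x | 0 <= x /\ (x = 0 \/ Omega p omega x \is a fin_num)].

Definition Omega_range (R : realType) (p : R) (omega : R -> R) : set (\bar R) :=
  Omega p omega @` Omega_dom p omega.

Definition Omega_inv (R : realType) (p : R) (omega : R -> R) : \bar R -> R :=
  'pinv_(fun=> 0) (Omega_dom p omega) (Omega p omega).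

Definition c_fun (R : realType) (beta q : R) (b : R -> R) (t : R) : R :=
  t `^ (beta - 1 + q^-1) * b t / (q * (beta - 1) + 1) `^ q^-1.

(* The argument of Omega_inv in the bound. *)
Definition Omega_arg (R : realType) (beta p q : R) (a b l omega : R -> R)
    (t : R) : \bar R :=
  (Omega p omega (a t `^ p) +
   (c_fun beta q b t `^ p *
    \int[lebesgue_measure]_(s in `[0, t]) (l s `^ p))%R%:E)%E.

(* Main.v *)
(* Put w = 2^(1-p) u^p, so that mu(w) = omega(u)^p. Hoelder's inequality with
   the exponents q, p on the kernel (t - s)^(beta-1), followed by the convexity
   of x^p, turns the hypothesis into
     w t <= A + C * int_0^t l^p mu(w) =: z t  on [0, t0],
   with A = a(t0)^p and C = c(t0)^p, since a and c are nondecreasing.  As w <= z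
   and mu is nondecreasing, z t - z s <= mu(z t) * C * int_s^t l^p; summing this
   over points where z takes equally spaced values bounds the lower sums of 1/mu,
   whence int_A^(z t0) 1/mu <= C * int_0^t0 l^p, including at zeros of mu.  So
   Omega(z t0) <= Omega(A) + C * int_0^t0 l^p, and Omega^-1 gives the bound. *)

Require Import Defs.
From HB Require Import structures.
From mathcomp Require Import all_boot all_order all_algebra.
From mathcomp Require Import all_classical all_reals all_analysis.
From mathcomp Require Import measurable_realfun ring lra.

Set Implicit Arguments.
Unset Strict Implicit.
Unset Printing Implicit Defensive.

Import Order.TTheory GRing.Theory Num.Theory.
Import numFieldNormedType.Exports.

Local Open Scope classical_set_scope.
Local Open Scope ring_scope.

(** * Integrals with endpoint singularities, and Hoelder's inequality *)

(** The endpoints are null and []a, b[] is an increasing union of closed intervals, so monotone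
    convergence carries a uniform bound to the limit. This keeps singularities at [a] or [b] out of
    later computations. *)
Lemma ge0_integral_itv_le (R : realType) (f : R -> \bar R) (a b : R)
    (K : \bar R) :
  measurable_fun `[a, b] f -> (forall x, a <= x <= b -> (0 <= f x)%E) ->
  (0 <= K)%E ->
  (forall x y, a < x -> x <= y -> y < b ->
    (\int[lebesgue_measure]_(t in `[x, y]) f t <= K)%E) ->
  (\int[lebesgue_measure]_(t in `[a, b]) f t <= K)%E.
Proof.
move=> mf f0 K0 fK.
rewrite integral_itv_bndoo; last first.
  by apply: measurable_funS mf => //; exact: subset_itv_oo_cc.
have [e [e0 e_ni e_small]] : exists e : nat -> R,
    [/\ forall n, 0 < e n, forall n, e n.+1 <= e n &
        forall d, 0 < d -> exists n, e n < d].
  exists (fun n => n.+1%:R^-1); split => [n|n|d d0].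
  - by rewrite invr_gt0.
  - by rewrite lef_pV2 ?posrE// ler_nat.
  - by have [n _ /(_ _ (leqnn n))] := near_infty_natSinv_lt (PosNum d0); exists n.
pose F n := `[a + e n, b - e n]%classic : set R.
have FE : `]a, b[%classic = \bigcup_n F n.
  apply/seteqP; split => [x /=|x [n _]]; rewrite /F/= !in_itv/= => /andP[ax xb].
    have [|n] := e_small (Num.min (x - a) (b - x)).
      by rewrite lt_min !subr_gt0 ax.
    rewrite lt_min => /andP[n1 n2]; exists n => //; rewrite /F/= in_itv/=.
    by apply/andP; split; lra.
  by apply/andP; have := e0 n; split; lra.
have Fab n : F n `<=` `[a, b].
  rewrite /F => x /=; rewrite !in_itv/= => /andP[n1 n2].
  by apply/andP; have := e0 n; split; lra.
have F_nd : nondecreasing_seq F.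
  apply/nondecreasing_seqP => n; rewrite subsetEset /F => x /=.
  rewrite !in_itv/= => /andP[n1 n2].
  by apply/andP; have := e_ni n; split; lra.
have mF n : measurable (F n) by exact: measurable_itv.
have mfF n : measurable_fun (F n) f by exact: measurable_funS mf.
have f0F n x : F n x -> (0 <= f x)%E.
  by move=> /Fab /=; rewrite in_itv/=; exact: f0.
have cvF : (\int[lebesgue_measure]_(x in F n) f x @[n --> \oo] -->
    \int[lebesgue_measure]_(x in \bigcup_n F n) f x)%E.
  exact: ge0_nondecreasing_set_cvg_integral.
rewrite FE -(cvg_lim _ cvF)//; apply: lime_le.
  by apply/cvg_ex; eexists; exact: cvF.
apply: nearW => n; rewrite /F.
(* For small [n] the interval [F n] may be empty; then [0 <= K] suffices. *)
have [h|h] := leP (a + e n) (b - e n).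
  by apply: fK => //; have := e0 n; lra.
by rewrite set_itv_ge ?integral_set0// bnd_simp -ltNge.
Qed.

(** For [g < 1] the integrand blows up as s tends to t, so the fundamental theorem of calculus is
    applied on compact subintervals of []0, t[], with primitive -(t - s)^g / g. *)
Lemma ge0_integral_powR_sub_le (R : realType) (g t : R) : 0 < g -> 0 <= t ->
  (\int[lebesgue_measure]_(s in `[0%R, t]) ((t - s) `^ (g - 1))%:E
    <= (t `^ g / g)%:E)%E.
Proof.
move=> g0 t0; apply: ge0_integral_itv_le => [|s _||x y x0 + yt].
- apply/measurable_EFinP/(measurableT_comp (measurable_powR _)).
  exact: measurable_funB.
- by rewrite lee_fin powR_ge0.
- by rewrite lee_fin divr_ge0 ?powR_ge0 ?ltW.
rewrite le_eqVlt => /predU1P[<-|xy].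
  by rewrite set_itv1 integral_set1 lee_fin divr_ge0 ?powR_ge0 ?ltW.
pose F s : R := - (g^-1 * (t - s) `^ g).
have dpow r s : s < t ->
    is_derive s 1 (fun s => (t - s) `^ r) (- (r * (t - s) `^ (r - 1))).
  move=> st; have ts0 : 0 < t - s by rewrite subr_gt0.
  have dts : is_derive s 1 (fun s => t - s) (- 1).
    have := is_deriveB (is_derive_cst t s 1) (is_derive_id s (1 : R)).
    by rewrite sub0r.
  have := @is_derive1_comp R (fun z => z `^ r) _ s _ _
    (@is_derive1_powR R r (t - s) ts0) dts.
  by rewrite mulrN1.
have dF s : s < t -> is_derive s 1 F ((t - s) `^ (g - 1)).
  move=> st; have := is_deriveN (is_deriveZ g^-1 (dpow g s st)).
  by rewrite /GRing.scale/= mulrN opprK mulrA mulVf ?gt_eqF// mul1r.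
have ltt s : s \in `[x, y] -> s < t.
  by rewrite in_itv/= => /andP[_ /le_lt_trans]; exact.
have cF s : s < t -> {for s, continuous F}.
  move=> st; apply: differentiable_continuous; apply/derivable1_diffP.
  by have [] := dF _ st.
have cf : {within `[x, y], continuous (fun s => (t - s) `^ (g - 1))}.
  by apply: derivable_within_continuous => s /ltt st; have [] := dpow (g - 1) s st.
rewrite (continuous_FTC2 xy cf (F := F)).
(* The integral is ((t - x)^g - (t - y)^g) / g: the subtracted term is dropped and t - x is replaced
   by t. *)
- rewrite /F -EFinB lee_fin opprK addrC mulrC lerBlDr.
  apply: (@le_trans _ _ (t `^ g / g)).
    rewrite ler_pM2r ?invr_gt0//; apply: ge0_ler_powR; rewrite ?nnegrE; lra.
  by rewrite lerDl mulr_ge0 ?powR_ge0// invr_ge0 ltW.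
- split.
  + move=> s /(subset_itv_oo_cc) /ltt st; by have [] := dF _ st.
  + by apply: cvg_at_right_filter; apply: cF; lra.
  + by apply: cvg_at_left_filter; apply: cF.
- move=> s /(subset_itv_oo_cc) /ltt st.
  by rewrite derive1E; have [] := dF _ st.
Qed.

(** Extending [f] and [g] by 0 outside [D] reduces this to Hoelder on the whole space; as the
    exponents are positive, 0^r = 0 and the extension adds nothing to the norms. *)
Lemma ge0_integral_hoelder d (T : measurableType d) (R : realType)
    (mu : {measure set T -> \bar R}) (D : set T) (f g : T -> R) (p q : R) :
  measurable D -> measurable_fun D f -> measurable_fun D g ->
  (forall x, D x -> 0 <= f x) -> (forall x, D x -> 0 <= g x) ->
  0 < p -> 0 < q -> p^-1 + q^-1 = 1 ->
  (\int[mu]_(x in D) (f x * g x)%:E <=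
   (\int[mu]_(x in D) (f x `^ p)%:E) `^ p^-1 *
   (\int[mu]_(x in D) (g x `^ q)%:E) `^ q^-1)%E.
Proof.
move=> mD mf mg f0 g0 p0 q0 pq.
have mfD : measurable_fun setT (f \_ D) by exact/(measurable_restrictT f mD).
have mgD : measurable_fun setT (g \_ D) by exact/(measurable_restrictT g mD).
have LE r (h : T -> R) : 0 < r -> (forall x, D x -> 0 <= h x) ->
    Lnorm mu r%:E (EFin \o (h \_ D)) = ((\int[mu]_(x in D) (h x `^ r)%:E) `^ r^-1)%E.
  move=> r0 h0; rewrite unlock; congr (_ `^ _)%E.
  rewrite [RHS]integral_mkcond; apply: eq_integral => x _ /=.
  rewrite !patchE; case: ifPn => [/set_mem Dx|_].
    by rewrite ger0_norm ?h0.
  by rewrite normr0 powR0 ?gt_eqF.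
have := hoelder mu mfD mgD p0 q0 pq.
rewrite !LE// Lnorm1; congr (_ <= _)%E.
rewrite [RHS]integral_mkcond; apply: eq_integral => x _ /=.
rewrite !patchE; case: ifPn => [/set_mem Dx|_]; last by rewrite mulr0 normr0.
by rewrite ger0_norm// mulr_ge0 ?f0 ?g0.
Qed.

(** * Integrals of the reciprocal of a nondecreasing function *)

Section inverse_nondecreasing.
Context (R : realType) (M : R -> R).
Hypothesis M_ge0 : forall x : R, 0 <= x -> 0 <= M x.
Hypothesis M_nd : forall x y : R, 0 <= x -> x <= y -> M x <= M y.

Local Notation mu := (@lebesgue_measure R).
Local Notation invM := (fun t : R => ((M t)%:E)^-1)%E.

Lemma measurable_inve_nondecreasing : measurable_fun (`[0, +oo[%classic : set R) invM.
Proof.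
(* [M] is monotone only on the half-line; [N] extends it monotonically, hence measurably, to all of
   R. Its zeros, where the reciprocal is +oo, are treated separately. *)
pose N t := M (Num.max 0 t).
have mN : measurable_fun [set: R] N.
  apply: nondecreasing_measurable => // s t st; apply: M_nd.
    by rewrite le_max lexx.
  by rewrite ge_max !le_max lexx/= st orbT.
pose h t := if N t == 0 then +oo%E else (N t `^ (-1))%:E.
apply: (@eq_measurable_fun _ _ _ _ _ h).
  move=> t; rewrite inE/= in_itv/= andbT => t0.
  by rewrite /h /N (max_idPr t0) inver powR_inv1 ?M_ge0.
apply: measurable_funTS; apply: measurable_fun_ifT.
- exact: measurable_fun_eqr.
- exact: measurable_cst.
- by apply/measurable_EFinP; apply: (measurableT_comp (measurable_powR _)).
Qed.

Lemma measurable_inve_nondecreasing_itv b1 b2 (x y : R) : 0 <= x ->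
  measurable_fun [set` Interval (BSide b1 x) (BSide b2 y)] invM.
Proof.
move=> x0; apply: measurable_funS measurable_inve_nondecreasing => // t /=.
rewrite !in_itv/= andbT => /andP[+ _].
by case: b1 => /= [|/ltW]; exact: le_trans.
Qed.

Lemma inve_nondecreasing_ge0 t : 0 <= t -> (0 <= invM t)%E.
Proof. by move=> t0; rewrite inve_ge0 lee_fin M_ge0. Qed.

Lemma inve_nondecreasing_le s t : 0 <= s -> s <= t -> (invM t <= invM s)%E.
Proof.
move=> s0 st; rewrite lee_pV2 ?lee_fin ?M_nd// inE lee_fin M_ge0//.
exact: le_trans st.
Qed.

Lemma inve_nondecreasing_gt0 t : 0 <= t -> (0 < invM t)%E.
Proof. by move=> t0; rewrite lt0e inve_nondecreasing_ge0// inve_eq0. Qed.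

Lemma integral_inve_split x y z : 0 <= x -> x <= y -> y <= z ->
  (\int[mu]_(t in `[x, z]) invM t =
   \int[mu]_(t in `[x, y]) invM t + \int[mu]_(t in `[y, z]) invM t)%E.
Proof.
move=> x0 xy yz; rewrite -(integral_itv_bndo_bndc (r := y)); last first.
  exact: measurable_inve_nondecreasing_itv.
rewrite (@itv_bndbnd_setU _ _ _ (BLeft y)) ?bnd_simp//.
rewrite ge0_integral_setU//.
- rewrite -itv_bndbnd_setU ?bnd_simp//.
  exact: measurable_inve_nondecreasing_itv.
- rewrite -itv_bndbnd_setU ?bnd_simp// => t /=; rewrite in_itv/= => /andP[xt _].
  by apply: inve_nondecreasing_ge0; exact: le_trans xt.
- apply/disj_setPS => t [/=]; rewrite !in_itv/= => /andP[_ ty] /andP[].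
  by rewrite leNgt ty.
Qed.

Lemma integral_inve_ge x y : 0 <= x -> x <= y ->
  (invM y * (y - x)%:E <= \int[mu]_(t in `[x, y]) invM t)%E.
Proof.
move=> x0 xy; have -> : ((y - x)%:E = mu `[x, y])%E.
  rewrite lebesgue_measure_itv/= lte_fin; case: ltP => // yx.
  by apply/congr1; apply/eqP; rewrite subr_eq0 eq_le yx xy.
rewrite -integral_cst//; apply: ge0_le_integral => //.
- by move=> t _; apply: inve_nondecreasing_ge0; exact: le_trans xy.
- exact: measurable_inve_nondecreasing_itv.
- move=> t /=; rewrite in_itv/= => /andP[xt ty].
  by apply: inve_nondecreasing_le => //; exact: le_trans xt.
Qed.

(** If [M x = 0] the bound is +oo, except for [x = y], where +oo * 0 = 0 is the integral over a
    point. *)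
Lemma integral_inve_le x y : 0 <= x -> x <= y ->
  (\int[mu]_(t in `[x, y]) invM t <= invM x * (y - x)%:E)%E.
Proof.
move=> x0 xy; have -> : ((y - x)%:E = mu `[x, y])%E.
  rewrite lebesgue_measure_itv/= lte_fin; case: ltP => // yx.
  by apply/congr1; apply/eqP; rewrite subr_eq0 eq_le yx xy.
rewrite -integral_cst//; apply: ge0_le_integral => //.
- move=> t /=; rewrite in_itv/= => /andP[xt ty].
  by apply: inve_nondecreasing_ge0; exact: le_trans xt.
- exact: measurable_inve_nondecreasing_itv.
- by move=> t /=; rewrite in_itv/= => /andP[xt ty]; exact: inve_nondecreasing_le.
Qed.

(** [M] is finite, so its reciprocal never vanishes. This makes [Omega] strictly increasing where it
    is finite. *)
Lemma integral_inve_gt0 x y : 0 <= x -> x < y ->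
  (0 < \int[mu]_(t in `[x, y]) invM t)%E.
Proof.
move=> x0 xy; apply: lt_le_trans (integral_inve_ge x0 (ltW xy)).
rewrite mule_gt0 ?lte_fin ?subr_gt0//; apply: inve_nondecreasing_gt0.
exact/ltW/(le_lt_trans x0).
Qed.

End inverse_nondecreasing.

(** * Separation of variables by finite increments *)

(** For smooth functions, dividing z' <= M(z) L' by M(z) and substituting x = z t gives the bound.
    Here increments replace derivatives: a rise of [z] by h up to the value v costs at least h / M v
    in [L], which is a term of a lower sum of 1 / M. *)
Lemma bihari_integral_le (R : realType) (M z L : R -> R) (T : R) :
  (forall x : R, 0 <= x -> 0 <= M x) ->
  (forall x y : R, 0 <= x -> x <= y -> M x <= M y) ->
  0 <= T -> {within `[0, T], continuous z} -> 0 <= z 0 ->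
  (forall s t, 0 <= s -> s <= t -> t <= T -> z s <= z t) ->
  (forall s t, 0 <= s -> s <= t -> t <= T -> L s <= L t) ->
  (forall s t, 0 <= s -> s <= t -> t <= T ->
    z t - z s <= M (z t) * (L t - L s)) ->
  (\int[lebesgue_measure]_(x in `[z 0%R, z T]) ((M x)%:E)^-1
    <= (L T - L 0)%:E)%E.
Proof.
move=> M0 Mnd T0 zc z0 znd Lnd zL.
(* Intermediate values turn a grid in the range of [z] into times. *)
have zsurj v : z 0 <= v -> v <= z T -> exists t, [/\ 0 <= t, t <= T & z t = v].
  move=> v0 vT; have z0T : z 0 <= z T by exact: znd.
  have [|t] := @IVT R z 0 T v T0 zc.
    by rewrite (min_idPl z0T) (max_idPr z0T) v0.
  by rewrite in_itv/= => /andP[t0 tT] <-; exists t.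
apply: ge0_integral_itv_le.
- exact: measurable_inve_nondecreasing_itv.
- by move=> x /andP[x0 _]; apply: inve_nondecreasing_ge0 => //; exact: le_trans x0.
- by rewrite lee_fin subr_ge0 Lnd.
move=> x y z0x + yzT.
have x0 : 0 <= x by lra.
rewrite le_eqVlt => /predU1P[<-|xy].
  by rewrite set_itv1 integral_set1 lee_fin subr_ge0 Lnd.
(* [z] must climb from [z 0] to [x > z 0], which the increment bound forbids if [M x = 0]. So zeros
   of [M] can occur only at the left end of the range, already cut off. *)
have Mx : 0 < M x.
  have [||t [t0 tT zt]] := zsurj x; [lra..|].
  have := zL 0 t (lexx _) t0 tT; rewrite zt => h.
  rewrite lt0r M0// andbT; apply/eqP => Mx0; move: h; rewrite Mx0; lra.
have Mgt v : x <= v -> 0 < M v by move=> xv; apply: lt_le_trans Mx _; exact: Mnd.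
(* the difference between the upper and the lower sum of the nonincreasing
   function 1 / M for the step h telescopes to h * (1 / M x - 1 / M (z t)) *)
have step h k t : 0 < h -> 0 <= t -> t <= T -> z t = x + k%:R * h ->
    (\int[lebesgue_measure]_(r in `[x, z t]) ((M r)%:E)^-1
      <= (L t - L 0 + h * ((M x)^-1 - (M (z t))^-1))%:E)%E.
  move=> h0; elim: k t => [|k IH] t t0 tT zt.
    rewrite zt mul0r addr0 set_itv1 integral_set1 subrr mulr0 addr0 lee_fin.
    by rewrite subr_ge0 Lnd.
  have kh0 : 0 <= k%:R * h by rewrite mulr_ge0 ?(ltW h0).
  have ztE : z t = x + k%:R * h + h by rewrite zt -natr1; ring.
  have ztT : z t <= z T by exact: znd.
  have [||s [s0 sT zs]] := zsurj (x + k%:R * h); [lra..|].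
  have st : s <= t.
    by rewrite leNgt; apply/negP => ts; have := znd t s t0 (ltW ts) sT; lra.
  have Mt := Mgt (z t); have Ms := Mgt (z s).
  rewrite (@integral_inve_split _ M M0 Mnd _ (z s)); [|lra..].
  apply: le_trans (leeD (IH s s0 sT zs)
    (@integral_inve_le _ M M0 Mnd (z s) (z t) _ _)) _; [lra..|].
  have Ms0 : 0 < M (z s) by apply: Ms; lra.
  have Mt0 : 0 < M (z t) by apply: Mt; lra.
  have zts : z t - z s = h by rewrite ztE zs; ring.
  have := zL s t s0 st tT; rewrite zts -ler_pdivrMl// => hL.
  rewrite inver gt_eqF// -EFinM -EFinD lee_fin.
  rewrite !mulrBr; lra.
(* The error in [step] is at most h / M x; n is taken so large that the mesh h = (y - x) / (n + 1)
   makes it at most e. *)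
apply/lee_addgt0Pr => e e0.
have d0 : 0 < e * M x / (y - x) by rewrite divr_gt0 ?mulr_gt0 ?subr_gt0.
have [n _ /(_ n (leqnn n)) /= nd] := near_infty_natSinv_lt (PosNum d0).
pose h := (y - x) * n.+1%:R^-1.
have h0 : 0 < h by rewrite mulr_gt0 ?subr_gt0 ?invr_gt0.
have [||t [t0 tT zt]] := zsurj y; [lra..|].
have := step h n.+1 t h0 t0 tT; rewrite zt => /(_ _)/le_trans; apply.
  by rewrite /h mulrCA mulfV ?pnatr_eq0// mulr1 addrC subrK.
rewrite -EFinD lee_fin; apply: lerD; first by rewrite lerB// Lnd.
have hMx : h * (M x)^-1 <= e.
  move: nd; rewrite ltr_pdivlMr ?subr_gt0// => nd.
  by rewrite ler_pdivrMr// /h mulrC ltW.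
have My0 : 0 < M y by apply: Mgt; lra.
have : 0 <= h * (M y)^-1 by rewrite mulr_ge0 ?invr_ge0 ?ltW.
by rewrite mulrBr; lra.
Qed.

(** * The function [Omega] and its inverse *)

Section Omega_theory.
Context (R : realType) (p : R) (omega : R -> R).
Hypothesis p_gt0 : 0 < p.
Hypothesis omega_ge0 : forall x, 0 <= x -> 0 <= omega x.
Hypothesis omega_nd : {in `[0, +oo[ &, {homo omega : x y / x <= y}}.

Local Notation mu := (@lebesgue_measure R).
Local Notation M := (mu_fun p omega).
Local Notation invM := (fun t : R => ((M t)%:E)^-1)%E.

Lemma mu_fun_ge0 (x : R) : 0 <= x -> 0 <= M x.
Proof. by move=> _; exact: powR_ge0. Qed.

Lemma mu_fun_nd (x y : R) : 0 <= x -> x <= y -> M x <= M y.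
Proof.
move=> x0 xy; have y0 := le_trans x0 xy.
have e0 r : 0 <= 2 `^ (1 - p^-1) * r `^ p^-1 :> R by rewrite mulr_ge0 ?powR_ge0.
have argxy : 2 `^ (1 - p^-1) * x `^ p^-1 <= 2 `^ (1 - p^-1) * y `^ p^-1 :> R.
  apply: ler_wpM2l; rewrite ?powR_ge0//.
  by apply: ge0_ler_powR; rewrite ?nnegrE// invr_ge0 ltW.
apply: ge0_ler_powR; rewrite ?nnegrE ?omega_ge0 ?e0 ?(ltW p_gt0)//.
by apply: omega_nd => //; rewrite in_itv/= e0.
Qed.

Let split := integral_inve_split mu_fun_ge0 mu_fun_nd.

Lemma integral_invM_ge0 (x y : R) : 0 <= x ->
  (0 <= \int[mu]_(t in `[x, y]) invM t)%E.
Proof.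
move=> x0; apply: integral_ge0 => t /=; rewrite in_itv/= => /andP[xt _].
by apply: (inve_nondecreasing_ge0 mu_fun_ge0); exact: le_trans xt.
Qed.

(** The cases follow the position of 1. When [x < 1], finiteness of [Omega x] is what allows the
    integral over [[x, 1]], or its pieces, to cancel. *)
Lemma OmegaD (x y : R) : 0 <= x -> x <= y -> Omega p omega x \is a fin_num ->
  (Omega p omega y = Omega p omega x + \int[mu]_(t in `[x, y]) invM t)%E.
Proof.
move=> x0 xy; rewrite /Omega.
have [x1|x1] := leP 1 x.
  by rewrite (le_trans x1 xy) => _; exact: split.
rewrite fin_numN; have [y1|y1] := leP 1 y => fx.
  by rewrite (split x0 (ltW x1) y1) addeA (addeC (- _)%E) subee// add0e.
move: fx; rewrite (split x0 xy (ltW y1)) ge0_fin_numE; last first.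
  by rewrite adde_ge0// integral_invM_ge0// (le_trans x0 xy).
move=> fx; have Ixy := @integral_invM_ge0 x y x0.
have Iy1 := @integral_invM_ge0 y 1 (le_trans x0 xy).
have f1 : (\int[mu]_(t in `[x, y]) invM t)%E \is a fin_num.
  by rewrite ge0_fin_numE// (le_lt_trans _ fx)// leeDl.
have f2 : (\int[mu]_(t in `[y, 1%R]) invM t)%E \is a fin_num.
  by rewrite ge0_fin_numE// (le_lt_trans _ fx)// leeDr.
by rewrite fin_num_oppeD// addeAC (addeC (- _)%E) subee// add0e.
Qed.

(** For [z < 1] only the integral over [[z, 1]] remains to be bounded, by a rectangle of height 1 /
    M z. This height is finite: if [M z = 0], the reciprocal would be +oo on all of [[0, z]]. *)
Lemma Omega0_fin_num (z : R) : 0 < z ->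
  (\int[mu]_(t in `[0%R, z]) invM t < +oo)%E -> Omega p omega 0 \is a fin_num.
Proof.
move=> z0 Iz; rewrite /Omega ler10 fin_numN ge0_fin_numE ?integral_invM_ge0//.
have [z1|z1] := leP 1 z.
  apply: le_lt_trans Iz; rewrite (split (lexx _) ler01 z1) leeDl//.
  exact: integral_invM_ge0.
rewrite (split (lexx _) (ltW z0) (ltW z1)) lte_add_pinfty//.
have := integral_inve_le mu_fun_ge0 mu_fun_nd (ltW z0) (ltW z1).
move=> /le_lt_trans; apply; rewrite lte_mul_pinfty//; last 1 first.
- by rewrite ltry.
- exact: (inve_nondecreasing_ge0 mu_fun_ge0 (ltW z0)).
rewrite ge0_fin_numE ?(inve_nondecreasing_ge0 mu_fun_ge0 (ltW z0))//.
rewrite ltey; apply/eqP => Mz.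
have := integral_inve_ge mu_fun_ge0 mu_fun_nd (lexx 0) (ltW z0).
by rewrite subr0 Mz gt0_mulye ?lte_fin// => /le_lt_trans/(_ Iz); rewrite ltxx.
Qed.

(** On the range the partial inverse is a right inverse with values in [Omega_dom]; its default
    value 0 is not involved. *)
Lemma Omega_inv_range (v : \bar R) : Omega_range p omega v ->
  Omega_dom p omega (Omega_inv p omega v) /\ Omega p omega (Omega_inv p omega v) = v.
Proof.
move=> v_range; split; last by apply: pinvK; rewrite inE.
by apply: (@surjpinv_image_sub _ _ _ _ (Omega_range p omega)); [exact: subset_refl|exists v].
Qed.

(* If Omega A is not finite, then A = 0 and Omega A = -oo, and the integral bound
   forces z = 0. *)
Lemma le_Omega_inv (A z K : R) : A <= z -> Omega_dom p omega A ->
  Omega_range p omega (Omega p omega A + K%:E)%E ->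
  (\int[mu]_(t in `[A, z]) invM t <= K%:E)%E ->
  z <= Omega_inv p omega (Omega p omega A + K%:E)%E.
Proof.
move=> Az domA /Omega_inv_range[]; set x := Omega_inv _ _ _ => -[x0 xdom] xE IK.
have [A0 _] := domA.
have [fA|nfA] := boolP (Omega p omega A \is a fin_num).
  (* If [x < z], expanding [Omega z] from x and from A gives equal values; the positive integral
     over [[x, z]] then makes [Omega x] less than [Omega A + K], which it equals. *)
  rewrite leNgt; apply/negP => xz.
  have fx : Omega p omega x \is a fin_num by rewrite xE fin_numD fA.
  have := OmegaD x0 (ltW xz) fx; rewrite (OmegaD A0 Az fA) => E.
  have : (Omega p omega A + K%:E < Omega p omega A + K%:E)%E.
    rewrite -{1}xE; apply: (@lt_le_trans _ _ (Omega p omega x +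
      \int[mu]_(t in `[x, z]) invM t)%E).
      by rewrite lteDl//; exact: (integral_inve_gt0 mu_fun_ge0 mu_fun_nd).
    by rewrite -E leeD2l.
  by rewrite ltxx.
case: domA => _ [A00|fA]; last by rewrite fA in nfA.
move: nfA IK xE; rewrite A00 => nf0 IK.
have -> : Omega p omega 0 = -oo%E.
  move: nf0; rewrite /Omega ler10 fin_numN ge0_fin_numE ?integral_invM_ge0//.
  by rewrite -leNgt leye_eq => /eqP ->.
move=> xE; case: xdom => [->|]; last by rewrite xE.
rewrite leNgt; apply/negP => z0; move/negP: nf0; apply.
by apply: (Omega0_fin_num z0); exact: le_lt_trans IK (ltry _).
Qed.

End Omega_theory.

(** * Bihari's inequality with constant coefficients *)

(** The witness is the value at [T] of the right-hand side z t of the hypothesis. Since w r <= z r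
    <= z t for r <= t, the increments of z satisfy [bihari_integral_le] with L = C times the
    integral of k. The result avoids [Omega], whose infinite values are handled in
    [le_Omega_inv]. *)
Lemma bihari (R : realType) (M k w : R -> R) (A C T : R)
    (mu := @lebesgue_measure R) :
  (forall x : R, 0 <= x -> 0 <= M x) ->
  (forall x y : R, 0 <= x -> x <= y -> M x <= M y) ->
  0 <= A -> 0 <= C -> 0 <= T ->
  (forall s, 0 <= s <= T -> 0 <= k s) -> (forall s, 0 <= s <= T -> 0 <= w s) ->
  mu.-integrable `[0, T] (EFin \o k) ->
  mu.-integrable `[0, T] (EFin \o (fun s => k s * M (w s))) ->
  (forall t, 0 <= t <= T ->
    w t <= A + C * \int[mu]_(s in `[0, t]) (k s * M (w s))) ->
  exists2 z, A <= z /\ w T <= z &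
    (\int[mu]_(x in `[A, z]) ((M x)%:E)^-1
      <= (C * \int[mu]_(s in `[0, T]) k s)%:E)%E.
Proof.
move=> M0 Mnd A0 C0 T0 k0 w0 ik ikM wle.
set kM := fun s => k s * M (w s) in ikM wle.
pose J (f : R -> R) t := \int[mu]_(s in `[0, t]) f s.
have kM0 s : 0 <= s <= T -> 0 <= kM s.
  by move=> sT; rewrite mulr_ge0 ?k0 ?M0 ?w0.
have sub t : t <= T -> `[0, t]%classic `<=` `[0, T]%classic.
  by move=> tT; apply: subset_itvl; rewrite bnd_simp.
have JB f s t : mu.-integrable `[0, T] (EFin \o f) -> 0 <= s -> s <= t -> t <= T ->
    J f t - J f s = \int[mu]_(r in `]s, t]) f r.
  move=> fi s0 st tT; apply: Rintegral_itvB; rewrite ?bnd_simp//.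
  by apply: integrableS fi => //; exact: sub.
have Jnd f : mu.-integrable `[0, T] (EFin \o f) ->
    (forall s, 0 <= s <= T -> 0 <= f s) ->
    forall s t, 0 <= s -> s <= t -> t <= T -> J f s <= J f t.
  move=> fi f0 s t s0 st tT; rewrite -subr_ge0 JB//.
  apply: Rintegral_ge0 => r /=; rewrite in_itv/= => /andP[sr rt].
  by apply: f0; lra.
have J00 f : J f 0 = 0 by rewrite /J set_itv1 Rintegral_set1.
pose z t := A + C * J kM t.
have z0 : z 0 = A by rewrite /z J00 mulr0 addr0.
have znd s t : 0 <= s -> s <= t -> t <= T -> z s <= z t.
  by move=> s0 st tT; rewrite lerD2l ler_wpM2l// (Jnd kM).
exists (z T); first by rewrite -z0 znd// wle// T0 lexx.
rewrite -z0; have -> : C * \int[mu]_(s in `[0, T]) k s = C * J k T - C * J k 0.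
  by rewrite J00 mulr0 subr0.
apply: (@bihari_integral_le _ M z (fun t => C * J k t) T) => //.
- have cJ := parameterized_integral_continuous T0 ikM.
  by move=> t; apply: cvgD; [exact: cvg_cst|apply: cvgM; [exact: cvg_cst|exact: cJ]].
- by rewrite z0.
- by move=> s t s0 st tT; rewrite ler_wpM2l// Jnd.
- move=> s t s0 st tT.
  have -> : z t - z s = C * (J kM t - J kM s) by rewrite /z; ring.
  rewrite -mulrBr mulrCA ler_wpM2l// !JB//.
  have ioc f : mu.-integrable `[0, T] (EFin \o f) ->
      mu.-integrable `]s, t] (EFin \o f).
    apply: integrableS => // r /=; rewrite !in_itv/= => /andP[sr rt].
    by apply/andP; split; lra.
  rewrite -RintegralZl//; last exact: ioc.
  apply: le_Rintegral => //; first exact: ioc.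
    exact: (integrableZl _ (M (z t)) (ioc _ ik)).
  move=> r /=; rewrite in_itv/= => /andP[sr rt].
  have r0T : 0 <= r <= T by apply/andP; split; lra.
  rewrite /kM mulrC ler_wpM2r ?k0// Mnd ?w0//.
  apply: le_trans (wle _ r0T) _.
  by apply: znd => //; lra.
Qed.

(** * Power inequalities and the singular kernel *)

(** Convexity of the p-th power at the midpoint of x and y, multiplied by 2. *)
Lemma powR_add_le (R : realType) (p x y : R) : 1 <= p -> 0 <= x -> 0 <= y ->
  2 `^ (1 - p) * (x + y) `^ p <= x `^ p + y `^ p.
Proof.
move=> p1 x0 y0.
have h0 : 0 <= 2^-1 :> R by lra.
have h1 : 2^-1 <= 1 :> R by lra.
have : (2^-1 * x + (1 - 2^-1) * y) `^ p <=
    2^-1 * x `^ p + (1 - 2^-1) * y `^ p.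
  by apply: (convex_powR p1 (Itv01 h0 h1)); rewrite inE/= in_itv/= ?x0 ?y0.
have -> : 1 - 2^-1 = 2^-1 :> R by lra.
rewrite -!mulrDr powRM ?addr_ge0 ?invr_ge0// => H.
have : 2 * (2^-1 `^ p * (x + y) `^ p) <= 2 * (2^-1 * (x `^ p + y `^ p)).
  by rewrite ler_pM2l.
rewrite !mulrA mulfV// mul1r; apply: le_trans.
have -> : 2^-1 `^ p = (2 `^ p)^-1 :> R.
  by rewrite -[2^-1]powR_inv1// -powRrM mulN1r powRN.
by rewrite powRB ?powRr1 ?pnatr_eq0 ?implybT.
Qed.

(** Hoelder raises the kernel to the power (beta - 1) q = g - 1, integrable because g > 0. The q-th
    root of t^g / g is the factor in front, which times b t is [c_fun]. *)
Lemma Rintegral_powR_sub_mul_le (R : realType) (beta p q t : R) (f : R -> R)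
    (mu := @lebesgue_measure R) :
  0 < p -> 0 < q -> p^-1 + q^-1 = 1 -> 0 < q * (beta - 1) + 1 -> 0 <= t ->
  (forall s, 0 <= s <= t -> 0 <= f s) -> measurable_fun `[0, t] f ->
  mu.-integrable `[0, t] (EFin \o (fun s => f s `^ p)) ->
  \int[mu]_(s in `[0, t]) ((t - s) `^ (beta - 1) * f s) <=
  t `^ (beta - 1 + q^-1) / (q * (beta - 1) + 1) `^ q^-1 *
    (\int[mu]_(s in `[0, t]) (f s `^ p)) `^ p^-1.
Proof.
move=> p0 q0 pq g0 t0 f0 mf ifp; set g := q * (beta - 1) + 1 in g0 *.
have mk r : measurable_fun `[0, t] (fun s => (t - s) `^ r).
  by apply: (measurableT_comp (measurable_powR _)); exact: measurable_funB.
have qp : q^-1 + p^-1 = 1 by rewrite addrC.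
have f0' s : `[0, t]%classic s -> 0 <= f s by rewrite /= in_itv/=; exact: f0.
have := @ge0_integral_hoelder _ _ R mu `[0, t] (fun s => (t - s) `^ (beta - 1))
  f q p (measurable_itv _) (mk _) mf (fun s _ => powR_ge0 _ _) f0' q0 p0 qp.
set X := (X in (X <= _)%E); set I := \int[mu]_(s in `[0, t]) (f s `^ p).
have -> : (\int[mu]_(s in `[0%R, t]) (f s `^ p)%:E = I%:E)%E.
  by rewrite /I /Rintegral fineK//; exact: integrable_fin_num.
have kE : (\int[mu]_(s in `[0%R, t]) (((t - s) `^ (beta - 1)) `^ q)%:E
    <= (t `^ g / g)%:E)%E.
  have gE : (beta - 1) * q = g - 1 by rewrite /g; ring.
  under eq_integral do rewrite -powRrM gE.
  exact: ge0_integral_powR_sub_le.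
move=> XI; have {XI} : (X <= (t `^ (beta - 1 + q^-1) / g `^ q^-1 * I `^ p^-1)%:E)%E.
  apply: le_trans XI _; rewrite EFinM; apply: lee_pmul; rewrite ?poweR_ge0//.
  have q'0 : 0 <= q^-1 by rewrite invr_ge0 ltW.
  apply: (@le_trans _ _ ((t `^ g / g)%:E `^ q^-1)%E).
    apply: gt0_ler_poweR => //; rewrite ?in_itv/=.
    - by rewrite leey andbT integral_ge0// => s _; rewrite lee_fin powR_ge0.
    - by rewrite leey andbT lee_fin divr_ge0 ?powR_ge0// ltW.
  rewrite poweR_EFin lee_fin powRM ?powR_ge0 ?invr_ge0 ?(ltW g0)//.
  rewrite -powRrM /g mulrDl mul1r mulrAC mulfV ?gt_eqF// mul1r -/g.
  have -> : g^-1 `^ q^-1 = (g `^ q^-1)^-1 :> R.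
    by rewrite -[g^-1]powR_inv1 ?(ltW g0)// -powRrM mulN1r powRN.
  by [].
(* The real integral is [fine X], so X must be shown finite before the extended bound transfers. *)
have X0 : (0 <= X)%E.
  apply: integral_ge0 => s /=; rewrite in_itv/= => s0.
  by rewrite lee_fin mulr_ge0 ?powR_ge0 ?f0.
move=> XI; rewrite -lee_fin /Rintegral -/X fineK//.
by rewrite ge0_fin_numE// (le_lt_trans XI)// ltry.
Qed.

(** Endpoints are null. This matters at 0, where nothing is known about the sign of [l]. *)
Lemma eq_Rintegral_itvcc (R : realType) (x y : R) (f g : R -> R) :
  measurable_fun `]x, y[ f -> measurable_fun `]x, y[ g ->
  {in `]x, y[, f =1 g} ->
  \int[lebesgue_measure]_(t in `[x, y]) f t =
  \int[lebesgue_measure]_(t in `[x, y]) g t.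
Proof. by move=> mf mg fg; rewrite /Rintegral (eq_integral_itv_bounded _ _ mf mg). Qed.

(** The exponents of 2, namely 1 - 1/p and (1 - p)/p, sum to 0. This inverts the substitution w =
    2^(1-p) u^p, both inside [mu_fun] and in the final bound. *)
Lemma powR_two_scaleK (R : realType) (p x : R) : 0 < p -> 0 <= x ->
  2 `^ (1 - p^-1) * (2 `^ (1 - p) * x `^ p) `^ p^-1 = x.
Proof.
move=> p0 x0; rewrite powRM ?powR_ge0// -!powRrM mulfV ?gt_eqF// powRr1//.
rewrite mulrA -powRD; last by rewrite pnatr_eq0 implybT.
by rewrite mulrBl mul1r mulfV ?gt_eqF// addrA subrK subrr powRr0 mul1r.
Qed.

Lemma mu_funK (R : realType) (p x : R) (omega : R -> R) : 0 < p -> 0 <= x ->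
  mu_fun p omega (2 `^ (1 - p) * x `^ p) = omega x `^ p.
Proof. by move=> p0 x0; rewrite /mu_fun powR_two_scaleK. Qed.

(** * Reduction of the singular inequality to Bihari's *)

Theorem theorem2p3 (R : realType) (T : \bar R) (beta p q : R)
  (a b l omega u : R -> R) (T1 : R)
  (T_gt0 : (0 < T)%E)
  (beta_gt0 : 0 < beta) (beta_lt1 : beta < 1)
  (p_gt : beta^-1 < p)
  (qE : q = p / (p - 1))
  (a_cont : {within co_itv T, continuous a})
  (a_ge0 : forall t, co_itv T t -> 0 <= a t)
  (a_nd : {in co_itv T &, {homo a : s t / s <= t}})
  (b_cont : {within co_itv T, continuous b})
  (b_ge0 : forall t, co_itv T t -> 0 <= b t)
  (b_nd : {in co_itv T &, {homo b : s t / s <= t}})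
  (l_cont : {within oo_itv T, continuous l})
  (l_Lp : Lp_loc p T l)
  (l_ge0 : forall t, oo_itv T t -> 0 <= l t)
  (omega_cont : {within `[0, +oo[, continuous omega})
  (omega_ge0 : forall x, 0 <= x -> 0 <= omega x)
  (omega_nd : {in `[0, +oo[ &, {homo omega : x y / x <= y}})
  (u_cont : {within co_itv T, continuous u})
  (u_ge0 : forall t, co_itv T t -> 0 <= u t)
  (u_le : forall t, co_itv T t ->
    u t <= a t + b t * \int[lebesgue_measure]_(s in `[0, t])
                         ((t - s) `^ (beta - 1) * l s * omega (u s)))
  (T1_gt0 : 0 < T1) (T1_ltT : (T1%:E < T)%E)
  (T1_dom : forall t, 0 <= t <= T1 ->
    Omega_dom p omega (a t `^ p) /\
    Omega_range p omega (Omega_arg beta p q a b l omega t)) :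
  forall t, 0 <= t <= T1 ->
    u t <= 2 `^ (1 - p^-1) *
           Omega_inv p omega (Omega_arg beta p q a b l omega t) `^ p^-1.
Proof.
move=> t0 /andP[t0_ge0 t0_le].
have p1 : 1 < p by rewrite (lt_trans _ p_gt)// invf_gt1.
have p0 : 0 < p by lra.
have q0 : 0 < q by rewrite qE; apply: divr_gt0; lra.
have pq : p^-1 + q^-1 = 1.
  by rewrite qE invf_div -{1}(div1r p) -mulrDl subrKC mulfV// gt_eqF.
have qVE : q^-1 = 1 - p^-1 by lra.
(* This is [p > 1 / beta] rewritten. It makes the power of t in [c_fun] nondecreasing and,
   multiplied by q, gives the integrability condition on the kernel. *)
have e0 : 0 < beta - 1 + q^-1.
  have : p^-1 < beta by rewrite -[beta]invrK ltf_pV2 ?posrE// invr_gt0.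
  lra.
have g0 : 0 < q * (beta - 1) + 1.
  have -> : q * (beta - 1) + 1 = q * (beta - 1 + q^-1).
    by rewrite [RHS]mulrDr mulfV ?gt_eqF.
  exact: mulr_gt0.
have coT t : 0 <= t <= T1 -> co_itv T t.
  move=> /andP[t_ge0 tT1]; split => //; apply: le_lt_trans T1_ltT.
  by rewrite lee_fin.
have ooT t : 0 < t <= T1 -> oo_itv T t.
  by move=> /andP[t_gt0 tT1]; have [|_] := coT t; [rewrite ltW//|split].
(* l 0 may be negative *)
pose l0 s := Num.max 0 (l s).
have l0_ge0 s : 0 <= l0 s by rewrite le_max lexx.
have l0E s : 0 < s <= T1 -> l0 s = l s.
  by move=> s0; apply/max_idPr/l_ge0/ooT.
have lLp := l_Lp T1 T1_gt0 T1_ltT.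
have ml : measurable_fun `[0, T1] l.
  move: (lLp) => /andP[/[!inE]/= ml _].
  exact/(measurable_restrictT l (measurable_itv _)).
have ml0 : measurable_fun `[0, T1] l0 by apply: measurable_maxr.
have ik1 : lebesgue_measure.-integrable `[0, T1] (EFin \o (fun s => l0 s `^ p)).
  have : lebesgue_measure.-integrable `[0, T1]
      (fun s => (`|(l \_ `[0, T1]) s| `^ p)%:E).
    by apply: integrableS (Lfun_integrable (ltW p1) lLp).
  (* Pointwise 0 <= [l0] <= |l|, including at s = 0. *)
  apply: le_integrable => //.
    apply/measurable_EFinP; exact: (measurableT_comp (measurable_powR _)).
  move=> s s0T1 /=; rewrite lee_fin ger0_norm ?powR_ge0// [leRHS]ger0_norm ?powR_ge0//.
  rewrite patchE mem_set//; apply: ge0_ler_powR; rewrite ?nnegrE// ?(ltW p0)//.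
  by rewrite /l0 ge_max normr_ge0 ler_norm.
have u_contT1 : {within `[0, T1], continuous u}.
  by apply: continuous_subspaceW u_cont => s /=; rewrite in_itv/=; exact: coT.
have mu_u : measurable_fun `[0, T1] u.
  exact: subspace_continuous_measurable_fun.
have mou : measurable_fun `[0, T1] (fun s => omega (u s)).
  (* A monotone extension of [omega] to R, hence measurable; it agrees with [omega] on the values of
     u. *)
  pose om x := omega (Num.max 0 x).
  apply: (@eq_measurable_fun _ _ _ _ _ (om \o u)).
    move=> s; rewrite inE/= in_itv/= => /coT/u_ge0 us.
    by rewrite /om (max_idPr us).
  apply: measurableT_comp mu_u; apply: nondecreasing_measurable => // x y xy.
  apply: omega_nd.
  - by rewrite in_itv/= andbT le_max lexx.
  - by rewrite in_itv/= andbT le_max lexx.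
  by rewrite ge_max !le_max lexx/= xy orbT.
(* The maximum of u on [[0, T1]] bounds [omega (u s)] by a constant, so F^p is integrable by
   comparison with a multiple of [l0]^p. *)
have [um um_in u_max] := EVT_max (ltW T1_gt0) u_contT1.
have omu_ge0 s : 0 <= s <= T1 -> 0 <= omega (u s).
  by move=> /coT/u_ge0; exact: omega_ge0.
have omu_le s : 0 <= s <= T1 -> omega (u s) <= omega (u um).
  move=> sT1; apply: omega_nd; rewrite ?in_itv/= ?andbT ?u_ge0//.
  - exact: coT.
  - by apply: coT; move: um_in; rewrite in_itv.
  - by apply: u_max; rewrite in_itv.
pose F s := l0 s * omega (u s).
pose k s := l0 s `^ p.
pose w s := 2 `^ (1 - p) * u s `^ p.
have kM s : 0 <= s <= T1 -> F s `^ p = k s * mu_fun p omega (w s).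
  move=> sT1; rewrite /F /k /w mu_funK//; last exact/u_ge0/coT.
  by rewrite powRM// omu_ge0.
have mF : measurable_fun `[0, T1] F by exact: measurable_funM.
have iF : lebesgue_measure.-integrable `[0, T1] (EFin \o (fun s => F s `^ p)).
  have : lebesgue_measure.-integrable `[0, T1]
      (fun s => (omega (u um) `^ p)%:E * (l0 s `^ p)%:E)%E.
    exact: integrableZl ik1.
  apply: le_integrable => //.
    by apply/measurable_EFinP; exact: (measurableT_comp (measurable_powR _)).
  move=> s /=; rewrite in_itv/= => sT1; rewrite lee_fin.
  have oum0 : 0 <= omega (u um) by apply: le_trans (omu_le s sT1); exact: omu_ge0.
  rewrite !ger0_norm ?mulr_ge0 ?powR_ge0// mulrC -powRM//.
  apply: ge0_ler_powR; rewrite ?nnegrE ?mulr_ge0 ?omu_ge0 ?(ltW p0)//.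
  by rewrite /F ler_wpM2l// omu_le.
have sub t : t <= T1 -> `[0, t]%classic `<=` `[0, T1]%classic.
  by move=> tT1; apply: subset_itvl; rewrite bnd_simp.
have subo t : t <= T1 -> `]0, t[%classic `<=` `[0, T1]%classic.
  by move=> tT1; apply: subset_trans (sub t tT1); exact: subset_itv_oo_cc.
pose c := c_fun beta q b.
have c_le t : 0 <= t <= t0 -> 0 <= c t <= c t0.
  move=> /andP[t_ge0 tt0].
  have tT : co_itv T t by apply: coT; lra.
  have t0T : co_itv T t0 by apply: coT; lra.
  rewrite /c /c_fun mulr_ge0 ?mulr_ge0 ?b_ge0 ?invr_ge0 ?powR_ge0//=.
  rewrite ler_wpM2r ?invr_ge0 ?powR_ge0// ler_pM ?powR_ge0 ?b_ge0//.
    by apply: ge0_ler_powR; rewrite ?nnegrE ?(ltW e0).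
  by apply: b_nd; rewrite ?inE.
(* The coefficients are frozen at t0, as [bihari] takes constants. *)
pose A := a t0 `^ p; pose C := c t0 `^ p.
pose J t := \int[lebesgue_measure]_(s in `[0, t]) (F s `^ p).
have J_ge0 t : 0 <= J t by apply: Rintegral_ge0 => s _; exact: powR_ge0.
have mker (t : R) : measurable_fun `]0, t[ (fun s => (t - s) `^ (beta - 1)).
  by apply: (measurableT_comp (measurable_powR _)); exact: measurable_funB.
have mls (t : R) : t <= T1 -> measurable_fun `]0, t[ l.
  by move=> tT1; apply: measurable_funS ml => //; exact: subo.
have u_leJ t : 0 <= t <= t0 -> u t <= a t0 + c t0 * J t `^ p^-1.
  move=> tt0; have [t_ge0 t_le0] := andP tt0.
  have tT1 : t <= T1 by lra.
  have tT : co_itv T t by apply: coT; rewrite t_ge0.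
  have t0T : co_itv T t0 by apply: coT; rewrite t0_ge0.
  have [c0 cc] := andP (c_le t tt0).
  apply: le_trans (u_le _ tT) _; apply: lerD; first by apply: a_nd; rewrite ?inE.
  (* Under the integral [l] is replaced by [l0], equal to it on []0, t[]. *)
  rewrite (@eq_Rintegral_itvcc _ _ _ _ (fun s => (t - s) `^ (beta - 1) * F s)).
  - apply: (@le_trans _ _ (c t * J t `^ p^-1)); last by rewrite ler_wpM2r ?powR_ge0.
    have -> : c t * J t `^ p^-1 = b t * (t `^ (beta - 1 + q^-1) /
        (q * (beta - 1) + 1) `^ q^-1 * J t `^ p^-1) by rewrite /c /c_fun; ring.
    rewrite ler_wpM2l ?b_ge0//; apply: Rintegral_powR_sub_mul_le => //.
    + move=> s /andP[s0 st]; rewrite mulr_ge0 ?omu_ge0//; lra.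
    + by apply: measurable_funS mF => //; exact: sub.
    + by apply: integrableS iF => //; exact: sub.
  - apply: measurable_funM; first exact: measurable_funM (mker t) (mls t tT1).
    by apply: measurable_funS mou => //; exact: subo.
  - by apply: measurable_funM => //; apply: measurable_funS mF => //; exact: subo.
  - move=> s; rewrite in_itv/= => /andP[s0 st].
    by rewrite /F mulrA l0E//; lra.
have w_le t : 0 <= t <= t0 -> w t <= A + C * J t.
  move=> tt0; have [c0 _] := andP (c_le t tt0).
  have c00 : 0 <= c t0 by apply: le_trans c0 _; have /andP[] := c_le t tt0.
  have a00 : 0 <= a t0 by apply/a_ge0/coT; rewrite t0_ge0.
  have := @powR_add_le R p (a t0) (c t0 * J t `^ p^-1) (ltW p1) a00.
  rewrite mulr_ge0 ?powR_ge0// => /(_ isT).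
  rewrite [_ `^ p in X in _ <= _ + X]powRM ?powR_ge0// -powRrM mulVf ?gt_eqF//.
  rewrite powRr1//; apply: le_trans.
  rewrite /w ler_wpM2l ?powR_ge0//; apply: ge0_ler_powR; rewrite ?nnegrE ?(ltW p0)//.
  - apply/u_ge0/coT; lra.
  - by apply: addr_ge0 => //; rewrite mulr_ge0 ?powR_ge0.
  - exact: u_leJ.
have [domA rangeA] : Omega_dom p omega A /\ Omega_range p omega
  (Omega_arg beta p q a b l omega t0) by apply: T1_dom; rewrite t0_ge0.
have argE : Omega_arg beta p q a b l omega t0 = (Omega p omega A +
    (C * \int[lebesgue_measure]_(s in `[0, t0]) k s)%:E)%E.
  rewrite /Omega_arg; congr (_ + (_ * _)%:E)%E.
  apply: eq_Rintegral_itvcc.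
  - by apply: (measurableT_comp (measurable_powR _)); exact: mls.
  - apply: (measurableT_comp (measurable_powR _)).
    by apply: measurable_funS ml0 => //; exact: subo.
  - move=> s; rewrite in_itv/= => /andP[s0 st]; rewrite /k l0E//; lra.
rewrite argE in rangeA *.
have in0T1 s : 0 <= s <= t0 -> 0 <= s <= T1 by move=> /andP[? ?]; lra.
have [||||||||||z [Az wz] Iz] := @bihari R (mu_fun p omega) k w A C t0.
- exact: mu_fun_ge0.
- exact: mu_fun_nd.
- exact: powR_ge0.
- exact: powR_ge0.
- by [].
- by move=> s _; exact: powR_ge0.
- by move=> s _; rewrite mulr_ge0 ?powR_ge0.
- by apply: integrableS ik1 => //; exact: sub.
- have : lebesgue_measure.-integrable `[0, t0] (EFin \o (fun s => F s `^ p)).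
    by apply: integrableS iF => //; exact: sub.
  apply: eq_integrable => // s; rewrite inE/= in_itv/= => /in0T1 sT1.
  by rewrite kM.
- move=> t tt0; have -> : \int[lebesgue_measure]_(s in `[0, t])
      (k s * mu_fun p omega (w s)) = J t; last exact: w_le.
  apply: eq_Rintegral => s; rewrite inE/= in_itv/= => /andP[s0 st].
  by rewrite kM//; apply: in0T1; move: tt0 => /andP[_ ?]; lra.
have wx := le_trans wz (le_Omega_inv p0 omega_ge0 omega_nd Az domA rangeA Iz).
set x := Omega_inv _ _ _ in wx *.
(* Undoing the substitution turns the bound on [w t0] into the bound on [u t0]. *)
have <- : 2 `^ (1 - p^-1) * w t0 `^ p^-1 = u t0.
  by apply: powR_two_scaleK => //; apply/u_ge0/coT; rewrite t0_ge0.
rewrite ler_wpM2l ?powR_ge0//; apply: ge0_ler_powR; rewrite ?nnegrE//.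
- by rewrite invr_ge0 ltW.
- by rewrite mulr_ge0 ?powR_ge0.
- by apply: le_trans wx; rewrite mulr_ge0 ?powR_ge0.
Qed.
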